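(* Let $R$ be a commutative ring with $1$, $a,b\in R$, let $(W,S)$ be a finite Coxeter system with longest element $w_0$, and let $H_W=H_W(a,b)$. There are $R$-algebra automorphisms $\phi,\theta$ and an $R$-algebra anti-automorphism $\chi$ of $H_W$ determined by $$\phi(\pi_s)=\pi_{w_0 s w_0},\qquad \theta(\pi_s)=a-\pi_s,\qquad \chi(\pi_s)=\pi_s\qquad (s\in S).$$ Furthermore, $\phi$, $\theta$ and $\chi$ commute with each other (under composition) and each of them is an involution (its square is the identity).
   Context: For a finite Coxeter system $(W,S)$ with Coxeter matrix $(m_{st})_{s,t\in S}$, the two variable Hecke algebra $H_W(a,b)$ is the associative unital $R$-algebra generated by $\pi_s$ ($s\in S$) subject to $\pi_s^2=a\pi_s+b$ for $s\in S$ and $\pi_s\pi_t\pi_s\cdots=\pi_t\pi_s\pi_t\cdots$ ($m_{st}$ factors on each side) for all $s\neq t$ in $S$. *)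

(* Defs.v *)
From HB Require Import structures.
From mathcomp Require Import all_boot all_order all_algebra all_fingroup.
From mathcomp Require Import generic_quotient boolp.

Set Implicit Arguments.
Unset Strict Implicit.
Unset Printing Implicit Defensive.

Import GRing.Theory.
Local Open Scope quotient_scope.
Local Open Scope ring_scope.

(* Associative unital algebras given by generators and relations.  The       *)
(* structures lalgType and algType of MathComp exclude the zero ring, which  *)
(* is allowed here both for R and for the algebra, so the presented algebra  *)
(* is equipped with the structures pzRingType and lmodType R, together with  *)
(* the compatibility lemmas palg_scaleAl and palg_scaleAr.                   *)

Section PresentedAlgebra.
Variables (R : comPzRingType) (I : Type).

Inductive term : Type :=
  | Gen (i : I)
  | Cst (r : R)                         (* r times the unit *)
  | Add of term & term
  | Mul of term & term.

HB.instance Definition _ := gen_eqMixin term.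
HB.instance Definition _ := gen_choiceMixin term.

(* The congruence generated by rels and the axioms of unital R-algebras; the *)
(* scalar action of r is multiplication by the central element Cst r.        *)
Inductive congr (rels : term -> term -> Prop) : term -> term -> Prop :=
  | congr_rel x y : rels x y -> congr rels x y
  | congr_refl x : congr rels x x
  | congr_sym x y : congr rels x y -> congr rels y x
  | congr_trans x y z : congr rels x y -> congr rels y z -> congr rels x z
  | congr_Add x x' y y' :
      congr rels x x' -> congr rels y y' -> congr rels (Add x y) (Add x' y')
  | congr_Mul x x' y y' :
      congr rels x x' -> congr rels y y' -> congr rels (Mul x y) (Mul x' y')
  | congr_addA x y z : congr rels (Add x (Add y z)) (Add (Add x y) z)
  | congr_addC x y : congr rels (Add x y) (Add y x)
  | congr_add0 x : congr rels (Add (Cst 0) x) x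
  | congr_addN x : congr rels (Add (Mul (Cst (-1)) x) x) (Cst 0)
  | congr_mulA x y z : congr rels (Mul x (Mul y z)) (Mul (Mul x y) z)
  | congr_mul1l x : congr rels (Mul (Cst 1) x) x
  | congr_mul1r x : congr rels (Mul x (Cst 1)) x
  | congr_mulDl x y z : congr rels (Mul (Add x y) z) (Add (Mul x z) (Mul y z))
  | congr_mulDr x y z : congr rels (Mul x (Add y z)) (Add (Mul x y) (Mul x z))
  | congr_cstD r r' : congr rels (Cst (r + r')) (Add (Cst r) (Cst r'))
  | congr_cstM r r' : congr rels (Cst (r * r')) (Mul (Cst r) (Cst r'))
  | congr_cstC r x : congr rels (Mul (Cst r) x) (Mul x (Cst r)).

Variable rels : term -> term -> Prop.

Definition congrb (x y : term) : bool := `[< congr rels x y >].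

Lemma congrb_equiv : equiv_class_of congrb.
Proof.
split=> [x|x y|y x z]; first by apply/asboolP/congr_refl.
  by apply/asboolP/asboolP; apply: congr_sym.
by move=> /asboolP xy /asboolP yz; apply/asboolP; apply: congr_trans xy yz.
Qed.

Canonical congrb_equivRel := EquivRelPack congrb_equiv.
Canonical congrb_encModRel := defaultEncModRel congrb.

Definition palg := {eq_quot congrb}.
HB.instance Definition _ : EqQuotient term congrb palg := EqQuotient.on palg.
HB.instance Definition _ := Choice.on palg.

Lemma palg_eqP (x y : term) : (\pi_palg x = \pi_palg y) <-> congr rels x y.
Proof.
split=> [/eqP|xy]; first by rewrite piE => /asboolP.
by apply/eqP; rewrite piE; apply/asboolP.
Qed.

Definition palg_zero : palg := \pi_palg (Cst 0).
Definition palg_one : palg := \pi_palg (Cst 1).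
Definition palg_add : palg -> palg -> palg := lift_op2 palg Add.
Definition palg_mul : palg -> palg -> palg := lift_op2 palg Mul.
Definition palg_scale (r : R) : palg -> palg := lift_op1 palg (Mul (Cst r)).
Definition palg_opp (x : palg) : palg := palg_scale (-1) x.

Lemma congr_repr x : congr rels (repr (\pi_palg x)) x.
Proof. by apply/palg_eqP; rewrite reprK. Qed.

Lemma palg_addE x y : palg_add (\pi_palg x) (\pi_palg y) = \pi_palg (Add x y).
Proof. by unlock palg_add; apply/palg_eqP; apply: congr_Add; apply: congr_repr. Qed.

Lemma palg_mulE x y : palg_mul (\pi_palg x) (\pi_palg y) = \pi_palg (Mul x y).
Proof. by unlock palg_mul; apply/palg_eqP; apply: congr_Mul; apply: congr_repr. Qed.

Lemma palg_scaleE r x : palg_scale r (\pi_palg x) = \pi_palg (Mul (Cst r) x).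
Proof.
unlock palg_scale.
by apply/palg_eqP; apply: congr_Mul; [apply: congr_refl | apply: congr_repr].
Qed.

Let palgE := (palg_addE, palg_mulE, palg_scaleE).

Lemma palg_addA : associative palg_add.
Proof.
move=> x y z; rewrite -[x]reprK -[y]reprK -[z]reprK !palgE.
apply/palg_eqP; exact: congr_addA.
Qed.

Lemma palg_addC : commutative palg_add.
Proof.
move=> x y; rewrite -[x]reprK -[y]reprK !palgE; apply/palg_eqP; exact: congr_addC.
Qed.

Lemma palg_add0 : left_id palg_zero palg_add.
Proof. move=> x; rewrite -[x]reprK !palgE; apply/palg_eqP; exact: congr_add0. Qed.

Lemma palg_addN : left_inverse palg_zero palg_opp palg_add.
Proof.
move=> x; rewrite -[x]reprK /palg_opp !palgE; apply/palg_eqP; exact: congr_addN.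
Qed.

HB.instance Definition _ :=
  GRing.isZmodule.Build palg palg_addA palg_addC palg_add0 palg_addN.

Lemma palg_mulA : associative palg_mul.
Proof.
move=> x y z; rewrite -[x]reprK -[y]reprK -[z]reprK !palgE.
apply/palg_eqP; exact: congr_mulA.
Qed.

Lemma palg_mul1l : left_id palg_one palg_mul.
Proof. move=> x; rewrite -[x]reprK !palgE; apply/palg_eqP; exact: congr_mul1l. Qed.

Lemma palg_mul1r : right_id palg_one palg_mul.
Proof. move=> x; rewrite -[x]reprK !palgE; apply/palg_eqP; exact: congr_mul1r. Qed.

Lemma palg_mulDl : left_distributive palg_mul palg_add.
Proof.
move=> x y z; rewrite -[x]reprK -[y]reprK -[z]reprK !palgE.
apply/palg_eqP; exact: congr_mulDl.
Qed.

Lemma palg_mulDr : right_distributive palg_mul palg_add.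
Proof.
move=> x y z; rewrite -[x]reprK -[y]reprK -[z]reprK !palgE.
apply/palg_eqP; exact: congr_mulDr.
Qed.

HB.instance Definition _ := GRing.Zmodule_isPzRing.Build palg
  palg_mulA palg_mul1l palg_mul1r palg_mulDl palg_mulDr.

Lemma palg_scaleA r s x :
  palg_scale r (palg_scale s x) = palg_scale (r * s) x.
Proof.
rewrite -[x]reprK !palgE; apply/palg_eqP.
apply: congr_trans (congr_mulA _ _ _ _) _.
by apply: congr_Mul; [apply/congr_sym/congr_cstM | apply: congr_refl].
Qed.

Lemma palg_scale1 : left_id 1 palg_scale.
Proof. move=> x; rewrite -[x]reprK !palgE; apply/palg_eqP; exact: congr_mul1l. Qed.

Lemma palg_scaleDr : right_distributive palg_scale +%R.
Proof.
move=> r x y; rewrite -[x]reprK -[y]reprK.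
change (palg_scale r (palg_add (\pi_palg (repr x)) (\pi_palg (repr y))) =
  palg_add (palg_scale r (\pi_palg (repr x))) (palg_scale r (\pi_palg (repr y)))).
by rewrite !palgE; apply/palg_eqP; exact: congr_mulDr.
Qed.

Lemma palg_scaleDl x : {morph palg_scale^~ x : r s / r + s}.
Proof.
move=> r s; rewrite -[x]reprK.
change (palg_scale (r + s) (\pi_palg (repr x)) =
  palg_add (palg_scale r (\pi_palg (repr x))) (palg_scale s (\pi_palg (repr x)))).
rewrite !palgE; apply/palg_eqP; apply: congr_trans (congr_mulDl _ _ _ _).
by apply: congr_Mul; [apply: congr_cstD | apply: congr_refl].
Qed.

HB.instance Definition _ := GRing.Zmodule_isLmodule.Build R palg
  palg_scaleA palg_scale1 palg_scaleDr palg_scaleDl.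

Lemma palg_piD (x y : term) : \pi_palg (Add x y) = \pi_palg x + \pi_palg y.
Proof. by rewrite -palg_addE. Qed.

Lemma palg_piM (x y : term) : \pi_palg (Mul x y) = \pi_palg x * \pi_palg y.
Proof. by rewrite -palg_mulE. Qed.

Lemma palg_piC (r : R) : \pi_palg (Cst r) = r *: (1 : palg).
Proof.
change (\pi_palg (Cst r) = palg_scale r (\pi_palg (Cst 1))).
by rewrite palg_scaleE; apply/palg_eqP/congr_sym/congr_mul1r.
Qed.

Lemma palg_scaleAl (r : R) (x y : palg) : r *: (x * y) = (r *: x) * y.
Proof.
rewrite -[x]reprK -[y]reprK.
change (palg_scale r (palg_mul (\pi_palg (repr x)) (\pi_palg (repr y))) =
  palg_mul (palg_scale r (\pi_palg (repr x))) (\pi_palg (repr y))).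
by rewrite !palgE; apply/palg_eqP; exact: congr_mulA.
Qed.

Lemma palg_scaleAr (r : R) (x y : palg) : r *: (x * y) = x * (r *: y).
Proof.
rewrite -[x]reprK -[y]reprK.
change (palg_scale r (palg_mul (\pi_palg (repr x)) (\pi_palg (repr y))) =
  palg_mul (\pi_palg (repr x)) (palg_scale r (\pi_palg (repr y)))).
rewrite !palgE; apply/palg_eqP.
apply: congr_trans (congr_mulA _ _ _ _) _.
apply: congr_trans (congr_sym (congr_mulA _ _ _ _)).
by apply: congr_Mul; [apply: congr_cstC | apply: congr_refl].
Qed.

Definition pgen (i : I) : palg := \pi_palg (Gen i).

Definition alg_automorphism (f : palg -> palg) : Prop :=
  [/\ linear f, monoid_morphism f & bijective f].

Definition alg_antiautomorphism (f : palg -> palg) : Prop :=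
  [/\ linear f, f 1 = 1, {morph f : x y / x * y >-> y * x} & bijective f].

End PresentedAlgebra.

Arguments Gen {R I} i.
Arguments Cst {R I} r.
Arguments alg_automorphism [R I] rels f.
Arguments alg_antiautomorphism [R I] rels f.

Section UniversalProperty.
Variables (R : comPzRingType) (I : Type) (rels : term R I -> term R I -> Prop).

Fixpoint term_eval (A : algType R) (f : I -> A) (x : term R I) : A :=
  match x with
  | Gen i => f i
  | Cst r => r%:A
  | Add x y => term_eval f x + term_eval f y
  | Mul x y => term_eval f x * term_eval f y
  end.

Lemma palg_universal (A : algType R) (f : I -> A) :
    (forall x y, rels x y -> term_eval f x = term_eval f y) ->
  exists g : palg rels -> A,
    [/\ linear g, monoid_morphism g, forall i, g (pgen rels i) = f i &
        forall h : palg rels -> A, linear h -> monoid_morphism h ->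
          (forall i, h (pgen rels i) = f i) -> h =1 g].
Proof.
move=> frels; pose g (x : palg rels) := term_eval f (repr x).
have evalP x y : congr rels x y -> term_eval f x = term_eval f y.
  elim=> {x y} /=.
  - exact: frels.
  - by [].
  - by [].
  - by move=> x y z _ -> _ ->.
  - by move=> x x' y y' _ -> _ ->.
  - by move=> x x' y y' _ -> _ ->.
  - by move=> *; rewrite addrA.
  - by move=> *; rewrite addrC.
  - by move=> *; rewrite scale0r add0r.
  - by move=> *; rewrite mulr_algl scaleN1r addNr scale0r.
  - by move=> *; rewrite mulrA.
  - by move=> *; rewrite scale1r mul1r.
  - by move=> *; rewrite scale1r mulr1.
  - by move=> *; rewrite mulrDl.
  - by move=> *; rewrite mulrDr.
  - by move=> *; rewrite scalerDl.
  - by move=> *; rewrite mulr_algl scalerA.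
  - by move=> *; rewrite mulr_algl mulr_algr.
have gE x : g (\pi_(palg rels) x) = term_eval f x by apply/evalP/congr_repr.
have gC (r : R) : g (r *: (1 : palg rels)) = r%:A by rewrite -palg_piC gE.
have gM : {morph g : x y / x * y}.
  by move=> x y; rewrite -[x]reprK -[y]reprK -palg_piM !gE.
have gD : {morph g : x y / x + y}.
  by move=> x y; rewrite -[x]reprK -[y]reprK -palg_piD !gE.
exists g; split.
- move=> r x y; rewrite gD; congr (_ + _).
  by rewrite -[x in LHS]mul1r palg_scaleAl gM gC mulr_algl.
- by split=> //; rewrite -[1 in LHS]scale1r gC scale1r.
- by move=> i; rewrite gE.
move=> h hL [h1 hM] hgen x; rewrite -[x]reprK gE.
elim: (repr x) => /= [i|r|y IHy z IHz|y IHy z IHz]; first exact: hgen.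
- rewrite palg_piC -[_ *: _]addr0 hL h1.
  by rewrite -[0 : palg _](addNr 1) -[- 1]scaleN1r hL scaleN1r addNr addr0.
- by rewrite palg_piD -[\pi_(palg rels) y]scale1r hL scale1r IHy IHz.
- by rewrite palg_piM hM IHy IHz.
Qed.

End UniversalProperty.

Section CoxeterSystem.
Local Open Scope group_scope.
Variables (gT : finGroupType) (S : {set gT}).

(* The entry m_st of the Coxeter matrix is the order #[s * t].  The last     *)
(* clause says that the relations (s t)^(m_st) = 1, which for s = t read     *)
(* s^2 = 1, define the group.                                                *)
Definition coxeter_system : Prop :=
  [/\ <<S>> = [set: gT],
      {in S, forall s, #[s] = 2} &
      forall (G : groupType) (f : gT -> G),
        {in S &, forall s t, (f s * f t) ^+ #[s * t] = 1} ->
        exists2 g : gT -> G, {morph g : x y / x * y} & {in S, g =1 f}].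

(* S ^+ n is the set of products of n elements of S. *)
Lemma coxeter_word : coxeter_system -> forall w, exists n, w \in S ^+ n.
Proof.
case=> genS _ _ w; have /gen_prodgP[n [c cS ->]] : w \in <<S>> by rewrite genS inE.
exists n; elim: n c cS => [|n IHn] c cS; first by rewrite big_ord0 expg0 inE.
by rewrite big_ord_recl expgS mem_mulg // IHn // => i; apply: cS.
Qed.

Definition coxeter_length (hS : coxeter_system) (w : gT) : nat :=
  ex_minn (coxeter_word hS w).

Definition longest_element (hS : coxeter_system) (w0 : gT) : Prop :=
  forall w, (coxeter_length hS w <= coxeter_length hS w0)%N.

End CoxeterSystem.

Section Hecke.
Variables (R : comPzRingType) (a b : R) (gT : finGroupType) (S : {set gT}).

Local Notation gen := {s : gT | s \in S}.

(* x y x ... with m factors *)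
Fixpoint alternating (m : nat) (x y : term R gen) : term R gen :=
  if m is m'.+1 then Mul x (alternating m' y x) else Cst 1.

Inductive hecke_rels : term R gen -> term R gen -> Prop :=
  | hecke_quadratic (s : gen) :
      hecke_rels (Mul (Gen s) (Gen s)) (Add (Mul (Cst a) (Gen s)) (Cst b))
  | hecke_braid (s t : gen) : s != t ->
      hecke_rels (alternating #[val s * val t]%g (Gen s) (Gen t))
                 (alternating #[val s * val t]%g (Gen t) (Gen s)).

Definition hecke_algebra : Type := palg hecke_rels.
HB.instance Definition _ := GRing.PzRing.on hecke_algebra.
HB.instance Definition _ := GRing.Lmodule.on hecke_algebra.

Definition hecke_gen (s : gen) : hecke_algebra := pgen hecke_rels s.

End Hecke.

Arguments hecke_rels [R] a b [gT] S _ _.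
Arguments hecke_algebra [R] a b [gT] S.
Arguments hecke_gen [R] a b [gT S] s.

Definition determined_by (T : Type) (class values : (T -> T) -> Prop)
    (f : T -> T) : Prop :=
  [/\ class f, values f & forall g, class g -> values g -> g =1 f].

(* Main.v *)
Require Import Defs.
From mathcomp Require Import all_boot all_order all_algebra all_fingroup.
From mathcomp Require Import generic_quotient.

(** Each of the three maps is prescribed on generators, so it exists as soon as
    the prescribed values satisfy the defining relations of the Hecke algebra
    (in the converse ring for [chi]), and two maps of the same kind are equal
    as soon as they agree on generators.  This settles uniqueness, the
    commutations and the involutivity, and leaves the relations.

    For [chi], reversing an alternating word gives an alternating word of the
    same length, so the reversed relations are again the relations.

    For [theta], the quadratic relation is a short computation.  For the braid
    relation, write D_k for the difference of the two alternating products of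
    length k in x and y.  The quadratic relations alone give the recursion
    D_(k+2) = (a - x - y) D_(k+1) - b D_k.  Replacing x, y by a - x, a - y
    changes the sign of D_1 and of the factor a - x - y, hence multiplies D_k
    by (-1)^k (lemma [alt_prod_sub]): D_m vanishes for one pair exactly when
    it does for the other.

    For [phi], the point is the group-theoretic fact that w0 is an involution
    and conjugation by w0 preserves S ([longest_element_conj]); it then
    preserves the orders m_st too.  Let W act on W x {+1, -1}, a generator s
    sending (t, e) to (t^s, -e) if t = s and to (t^s, e) otherwise; the Coxeter
    relations hold for these permutations, so the action exists.  It records
    for each w a set N w of reflections, with the cocycle rule that N (xy) is
    the symmetric difference of N x and x (N y) x^-1.  On a reduced word, N w
    is the list of the reflections that delete one letter, and these are
    distinct, so the length of w is the cardinal of N w ([inversion_sets]).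
    For the longest element, N w0 is the set of all reflections, which is
    stable under conjugation; the cocycle rule then shows that N (w0 w0) is
    empty and that N (w0 s w0) has one element, so w0 w0 = 1 and w0 s w0 has
    length 1. *)

Set Implicit Arguments.
Unset Strict Implicit.
Unset Printing Implicit Defensive.

Import GRing.Theory.

(** * Signed conjugation and the Coxeter relations *)

Section Cocycle.
Local Open Scope group_scope.
Variable gT : finGroupType.
Implicit Types (s t u w x y : gT) (ws : seq gT).

(** The sign is a boolean, [true] standing for -1. *)
Definition signed_conj s (p : gT * bool) := (p.1 ^ s, p.2 (+) (p.1 == s)).

Lemma signed_conj_inj s : injective (signed_conj s).
Proof.
by move=> [t d] [u e] [/conjg_inj -> /= /(can_inj (addbK _)) ->].
Qed.

Definition signed_perm s : {perm gT * bool} := perm (@signed_conj_inj s).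

Lemma conjgg x : x ^ x = x.
Proof. by rewrite conjgE mulKg. Qed.

Lemma invol_mulg s : #[s] = 2 -> s * s = 1.
Proof. by move=> s2; rewrite -expg2 -s2 expg_order. Qed.

Lemma invol_conj_eq s x y : #[s] = 2 -> (x ^ s == y) = (x == y ^ s).
Proof.
by move=> /invol_mulg s2; rewrite -(inj_eq (@conjg_inj _ s)) -conjgM s2 conjg1.
Qed.

(** As s inverts c = s t, conjugating a reflection c^j s of the dihedral group
    by the k-th power of c shifts its index by 2k. *)
Lemma conj_power_eq s t k u : #[s] = 2 -> #[t] = 2 ->
  forall j, (u ^ ((s * t) ^+ k) == (s * t) ^+ j * s)
            = (u == (s * t) ^+ (k.*2 + j) * s).
Proof.
move=> /invol_mulg s2 /invol_mulg t2 j; set c := s * t.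
have sV : s^-1 = s by apply/eqP; rewrite eq_invg_mul s2.
have tV : t^-1 = t by apply/eqP; rewrite eq_invg_mul t2.
have cs n : s * (c ^+ n)^-1 = c ^+ n * s.
  have -> : (c ^+ n)^-1 = (c ^+ n) ^ s.
    by rewrite conjXg -expVgn /c invMg sV tV conjgE sV !mulgA s2 mul1g.
  by rewrite conjgE sV !mulgA s2 mul1g.
rewrite -(inj_eq (@conjg_inj _ (c ^+ k)^-1)) conjgK.
congr (u == _); rewrite conjgE invgK -!mulgA cs !mulgA -!expgD.
by rewrite addnAC addnn.
Qed.

(** The sign of u flips at each step where the word s t s t ... meets u; the
    reflections met by a word of length 2k are the (s t)^j s with j < 2k. *)
Lemma signed_perm_power s t k u e : #[s] = 2 -> #[t] = 2 ->
  ((signed_perm s * signed_perm t) ^+ k) (u, e) =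
  (u ^ ((s * t) ^+ k),
   e (+) \big[addb/false]_(0 <= j < k.*2) (u == (s * t) ^+ j * s)).
Proof.
move=> s2 t2; elim: k => [|k IHk].
  by rewrite !expg0 perm1 conjg1 big_geq // addbF.
rewrite expgSr permM IHk permM !permE /signed_conj /= -!conjgM -expgSr.
rewrite doubleS !big_nat_recr //= -!addbA; congr (_, _ (+) (_ (+) (_ (+) _))).
  by have := conj_power_eq k u s2 t2 0; rewrite expg0 mul1g addn0.
have := conj_power_eq k u s2 t2 1; rewrite expg1 addn1 => <-.
have sV : s^-1 = s by apply/eqP; rewrite eq_invg_mul invol_mulg.
by rewrite conjgM (invol_conj_eq _ _ s2) (conjgE t) sV mulgA.
Qed.

(** With k the order m of s t, the 2m reflections met run twice through the same
    list of length m, so the sign flips cancel. *)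
Lemma signed_perm_order s t : #[s] = 2 -> #[t] = 2 ->
  (signed_perm s * signed_perm t) ^+ #[s * t] = 1.
Proof.
move=> s2 t2; apply/permP=> -[u e].
rewrite signed_perm_power // expg_order conjg1 perm1; congr (_, _).
rewrite -addnn (big_cat_nat (n := #[s * t])) ?leq_addr //=.
rewrite -{2}[#[s * t]]addn0 addnC big_addn addnK.
rewrite [X in _ (+) (_ (+) X)](eq_bigr (fun j => u == (s * t) ^+ j * s)).
  by rewrite addbb addbF.
by move=> j _; rewrite expgD expg_order mulg1.
Qed.

End Cocycle.

(** * Inversion sets and the longest element *)

Section Longest.
Local Open Scope group_scope.
Variables (gT : finGroupType) (S : {set gT}).
Hypothesis hS : coxeter_system S.
Implicit Types (s t u w x y : gT) (ws : seq gT).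

Lemma coxeter_gen_order s : s \in S -> #[s] = 2.
Proof. by case: hS => _ S2 _; apply: S2. Qed.

Lemma coxeter_genV s : s \in S -> s^-1 = s.
Proof.
by move=> /coxeter_gen_order s2; apply/eqP; rewrite eq_invg_mul invol_mulg.
Qed.

Lemma expset_wordP w n :
  reflect (exists ws, [/\ all [in S] ws, size ws = n & \prod_(s <- ws) s = w])
          (w \in S ^+ n).
Proof.
apply: (iffP idP) => [|[ws [wsS <- <-]]].
  elim: n w => [|n IHn] w.
    by rewrite expg0 inE => /eqP->; exists [::]; rewrite big_nil.
  rewrite expgS => /mulsgP[s x sS /IHn[ws [wsS <- <-]] ->].
  by exists (s :: ws); rewrite /= sS wsS big_cons.
elim: ws wsS => [_|s ws IHws /= /andP[sS /IHws wsS]].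
  by rewrite big_nil inE.
by rewrite expgS big_cons mem_mulg.
Qed.

Lemma coxeter_length_le ws :
  all [in S] ws -> coxeter_length hS (\prod_(s <- ws) s) <= size ws.
Proof.
move=> wsS; rewrite /coxeter_length; case: ex_minnP => m _; apply.
by apply/expset_wordP; exists ws.
Qed.

Lemma reduced_word w :
  exists ws, [/\ all [in S] ws, size ws = coxeter_length hS w &
                 \prod_(s <- ws) s = w].
Proof. by apply/expset_wordP; rewrite /coxeter_length; case: ex_minnP. Qed.

(** For the word s_1 ... s_k, the i-th entry is
    (s_1 ... s_(i-1)) s_i (s_1 ... s_(i-1))^-1, the reflection whose left
    multiplication deletes the i-th letter; as each s_i is an involution,
    conjugation on either side is the same. *)
Fixpoint inversions ws : seq gT :=
  if ws is s :: ws' then s :: [seq t ^ s | t <- inversions ws'] else [::].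

Lemma size_inversions ws : size (inversions ws) = size ws.
Proof. by elim: ws => //= s ws <-; rewrite size_map. Qed.

Lemma inversion_deletion ws t : all [in S] ws -> t \in inversions ws ->
  exists ws', [/\ all [in S] ws', (size ws').+1 = size ws &
                  \prod_(s <- ws') s = t * \prod_(s <- ws) s].
Proof.
elim: ws t => [|s ws IHws] //= t /andP[sS wsS]; rewrite inE big_cons.
have s2 := invol_mulg (coxeter_gen_order sS).
case/predU1P=> [->|/mapP[u u_ws ->]].
  by exists ws; rewrite mulgA s2 mul1g.
have [ws' [ws'S szws' ws'E]] := IHws u wsS u_ws.
exists (s :: ws'); rewrite /= sS ws'S szws' big_cons ws'E; split=> //.
rewrite conjgE coxeter_genV // -!mulgA; congr (s * (u * _)).
by rewrite mulgA s2 mul1g.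
Qed.

(** If the first letter s occurred again among the inversions, deleting the
    corresponding later letter would write s times the rest, which is the whole
    product, with two letters less. *)
Lemma reduced_uniq ws : all [in S] ws ->
  coxeter_length hS (\prod_(s <- ws) s) = size ws -> uniq (inversions ws).
Proof.
elim: ws => [|s ws IHws] //= /andP[sS wsS]; rewrite big_cons => red.
rewrite (map_inj_uniq (@conjg_inj _ s)) IHws // ?andbT; last first.
  apply/eqP; rewrite eqn_leq coxeter_length_le //=.
  have [ws' [ws'S szws' ws'E]] := reduced_word (\prod_(t <- ws) t).
  rewrite -szws' -ltnS -red -ws'E.
  have := @coxeter_length_le (s :: ws').
  by rewrite /= sS big_cons => /(_ ws'S).
apply/negP=> /mapP[u u_ws su].
have us : u = s by apply: (@conjg_inj _ s); rewrite -su conjgg.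
rewrite {u su}us in u_ws.
have [ws' [ws'S szws' ws'E]] := inversion_deletion wsS u_ws.
have := coxeter_length_le ws'S.
by rewrite ws'E red -szws' ltnNge ltnW.
Qed.

(** [N w] collects the t whose sign is flipped by the image of w under the
    homomorphism to signed permutations that the Coxeter presentation provides.
    Being read off this homomorphism, it does not depend on a word for w; on a
    reduced word it is the list of inversions. *)
Lemma inversion_sets : exists N : gT -> {set gT},
  [/\ forall x y t, (t \in N (x * y)) = (t \in N x) (+) (t ^ x \in N y),
      forall s, s \in S -> N s = [set s],
      forall w, coxeter_length hS w = #|N w| &
      forall w t, t \in N w -> coxeter_length hS (t * w) < coxeter_length hS w].
Proof.
have [_ _ univ] := hS.
have [g gM gS] : exists2 g : gT -> {perm gT * bool},
    {morph g : x y / x * y} & {in S, g =1 @signed_perm gT}.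
  apply: univ => s t sS tS.
  by apply: signed_perm_order; apply: coxeter_gen_order.
have g1 : g 1 = 1 by apply: (mulgI (g 1)); rewrite -gM !mulg1.
have gE ws t e : all [in S] ws -> g (\prod_(s <- ws) s) (t, e) =
    (t ^ \prod_(s <- ws) s, e (+) odd (count_mem t (inversions ws))).
  elim: ws t e => [|s ws IHws] t e /=.
    by rewrite big_nil g1 perm1 conjg1 addbF.
  case/andP=> sS wsS; rewrite big_cons gM permM (gS s) // permE /signed_conj /=.
  rewrite IHws // -conjgM oddD oddb addbA eq_sym; congr (_, _ (+) odd _).
  rewrite count_map; apply: eq_count => u /=.
  by rewrite invol_conj_eq // coxeter_gen_order.
pose N w := [set t | (g w (t, false)).2].
have NE ws t : all [in S] ws ->
    (t \in N (\prod_(s <- ws) s)) = odd (count_mem t (inversions ws)).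
  by move=> wsS; rewrite inE gE.
have NEg w t e : g w (t, e) = (t ^ w, e (+) (t \in N w)).
  by have [ws [wsS _ <-]] := reduced_word w; rewrite NE // gE.
have redN w : exists ws, [/\ all [in S] ws, size ws = coxeter_length hS w,
    \prod_(s <- ws) s = w, uniq (inversions ws) & N w =i inversions ws].
  have [ws [wsS szws wsE]] := reduced_word w; exists ws.
  have uws : uniq (inversions ws) by apply: reduced_uniq; rewrite // wsE.
  split=> // t; rewrite -wsE NE // count_uniq_mem //; by case: (_ \in _).
exists N; split.
- by move=> x y t; rewrite inE gM permM NEg NEg.
- by move=> s sS; apply/setP=> t; rewrite !inE gS // permE /=.
- move=> w; have [ws [_ <- _ uws Nws]] := redN w.
  by rewrite (eq_card Nws) (card_uniqP uws) size_inversions.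
move=> w t; have [ws [wsS szws wsE _ ->]] := redN w.
move=> /(inversion_deletion wsS)[ws' [ws'S szws' ws'E]].
by rewrite -{1}wsE -ws'E -szws -szws' ltnS coxeter_length_le.
Qed.

(** A reflection t always lies in N t.  If it were not in N w0, the cocycle rule
    would put it in N (t w0), so that w0 = t (t w0) would be shorter than t w0,
    against maximality.  So N w0 is the conjugation-stable set of all
    reflections, and the cocycle rule computes N (w0 w0) and N (w0 s w0). *)
Lemma longest_element_conj w0 : longest_element hS w0 ->
  w0 * w0 = 1 /\ {in S, forall s, w0 * s * w0 \in S}.
Proof.
move=> max_w0; have [N [NM NS lN delN]] := inversion_sets.
have N1 t : t \in N 1 = false.
  by have := NM 1 1 t; rewrite mulg1 conjg1; case: (_ \in _).
have length0 w : (coxeter_length hS w == 0) = (w == 1).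
  apply/eqP/eqP => [l0|->].
    have [ws [_ szws <-]] := reduced_word w.
    by move: szws; rewrite l0 => /size0nil->; rewrite big_nil.
  rewrite lN; apply/eqP; rewrite cards_eq0; apply/eqP/setP=> t.
  by rewrite N1 inE.
have N_refl s x : s \in S -> s ^ x \in N (s ^ x).
  (* In N (x^-1 s x), the outer factors contribute the same parity at s ^ x by
     the rule for x^-1 x = 1, and s contributes 1. *)
  move=> sS; have := NM x^-1 x (s ^ x); rewrite mulVg N1 conjgK.
  rewrite {3}conjgE !NM (NS s) // conjgK conjgg !inE eqxx.
  by case: (_ \in N x^-1); case: (_ \in N x).
have N_w0 t : (t \in N w0) = (t \in class_support S [set: gT]).
  apply/idP/imset2P=> [|[s x sS _ ->]].
    have [ws [wsS _ <-]] := reduced_word w0.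
    elim: ws t wsS => [|s ws IHws] t /=; first by rewrite big_nil N1.
    case/andP=> sS wsS; rewrite big_cons NM NS // inE.
    case: eqP => [-> _|_ /(IHws _ wsS)[u x uS _ tE]].
      by exists s 1; rewrite ?inE ?conjg1.
    by exists u (x * s^-1); rewrite ?inE // conjgM -tE conjgK.
  have s2 : (s ^ x) * (s ^ x) = 1.
    by rewrite -conjMg (invol_mulg (coxeter_gen_order sS)) conj1g.
  apply: contraT => tN.
  have tN' : s ^ x \in N (s ^ x * w0).
    by rewrite NM N_refl // conjgg (negbTE tN).
  have := delN _ _ tN'; rewrite mulgA s2 mul1g ltnNge.
  by rewrite max_w0.
have classJ t x : (t ^ x \in N w0) = (t \in N w0).
  have imp u y : u \in N w0 -> u ^ y \in N w0.
    rewrite !N_w0 => /imset2P[s z sS _ ->]; rewrite -conjgM.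
    by apply/imset2P; exists s (z * y); rewrite ?inE.
  by apply/idP/idP=> [/imp-/(_ x^-1)|/imp//]; rewrite conjgK.
have w02 : w0 * w0 = 1.
  apply/eqP; rewrite -length0 lN cards_eq0; apply/eqP/setP=> t.
  by rewrite NM classJ addbb inE.
split=> // s sS.
have : coxeter_length hS (w0 * s * w0) = 1%N.
  rewrite lN; apply/eqP/cards1P; exists (s ^ w0^-1); apply/setP=> t.
  rewrite !NM (NS s) // classJ !inE addbAC addbb addFb.
  by rewrite -[s in LHS](conjgKV w0) (inj_eq (@conjg_inj _ w0)).
have [[|u [|v ws]] [wsS <- <-]] := reduced_word (w0 * s * w0);
  rewrite ?big_nil //.
by move=> _; rewrite big_seq1; move: wsS => /= /andP[].
Qed.
End Longest.

(** * Maps out of an algebra given by generators and relations *)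

Local Open Scope ring_scope.

Section PresentedAlgebraMaps.
Variables (R : comPzRingType) (I : Type) (rels : term R I -> term R I -> Prop).
Local Notation palg := (palg rels).

(** The scalars act through [c] rather than through an algebra structure on [A],
    so that [A] may be a zero ring or a converse ring. *)
Fixpoint term_val (A : pzRingType) (c : R -> A) (f : I -> A)
    (x : term R I) : A :=
  match x with
  | Gen i => f i
  | Cst r => c r
  | Add x y => term_val c f x + term_val c f y
  | Mul x y => term_val c f x * term_val c f y
  end.

Lemma palg_lift (A : pzRingType) (c : R -> A) (f : I -> A) :
    zmod_morphism c -> monoid_morphism c -> (forall r x, c r * x = x * c r) ->
    (forall x y, rels x y -> term_val c f x = term_val c f y) ->
  exists g : palg -> A,
    [/\ {morph g : x y / x + y}, {morph g : x y / x * y}, g 1 = 1,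
        forall r, g (r *: (1 : palg)) = c r & forall i, g (pgen rels i) = f i].
Proof.
move=> cB [c1 cM] cC frels.
have c0 : c 0 = 0 by rewrite -[0 in LHS](subrr 0) cB subrr.
have cN r : c (- r) = - c r by rewrite -[- r]sub0r cB c0 sub0r.
have cD r r' : c (r + r') = c r + c r' by rewrite -[r' in LHS]opprK cB cN opprK.
have valP x y : congr rels x y -> term_val c f x = term_val c f y.
  elim=> {x y} /=.
  - exact: frels.
  - by [].
  - by [].
  - by move=> x y z _ -> _ ->.
  - by move=> x x' y y' _ -> _ ->.
  - by move=> x x' y y' _ -> _ ->.
  - by move=> *; rewrite addrA.
  - by move=> *; rewrite addrC.
  - by move=> *; rewrite c0 add0r.
  - by move=> *; rewrite cN c1 mulN1r addNr c0.
  - by move=> *; rewrite mulrA.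
  - by move=> *; rewrite c1 mul1r.
  - by move=> *; rewrite c1 mulr1.
  - by move=> *; rewrite mulrDl.
  - by move=> *; rewrite mulrDr.
  - by [].
  - by move=> *; rewrite cM.
  - by move=> *; rewrite cC.
pose g (x : palg) := term_val c f (repr x).
have gE x : g (\pi_palg x)%qT = term_val c f x by apply/valP/congr_repr.
exists g; split.
- by move=> x y; rewrite -[x]reprK -[y]reprK -palg_piD !gE.
- by move=> x y; rewrite -[x]reprK -[y]reprK -palg_piM !gE.
- by rewrite -c1; apply: (gE (Cst 1)).
- by move=> r; rewrite -palg_piC gE.
- by move=> i; rewrite gE.
Qed.

Lemma palg_gen_ind (P : palg -> Prop) :
    (forall i, P (pgen rels i)) -> (forall r : R, P (r *: (1 : palg))) ->
    (forall x y, P x -> P y -> P (x + y)) ->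
    (forall x y, P x -> P y -> P (x * y)) ->
  forall x, P x.
Proof.
move=> Pgen P1 PD PM x; rewrite -[x]reprK.
elim: (repr x) => [i|r|y Py z Pz|y Py z Pz]; first exact: Pgen.
- by rewrite palg_piC.
- by rewrite palg_piD; apply: PD.
- by rewrite palg_piM; apply: PM.
Qed.

Definition palg_cst (r : R) : palg := r *: (1 : palg).

Lemma palg_cstB : zmod_morphism palg_cst.
Proof. by move=> r s; rewrite /palg_cst scalerBl. Qed.

Lemma palg_cst_mull r x : palg_cst r * x = r *: x.
Proof. by rewrite -palg_scaleAl mul1r. Qed.

Lemma palg_cst_mulr r x : x * palg_cst r = r *: x.
Proof. by rewrite -palg_scaleAr mulr1. Qed.

Lemma palg_cstC r x : palg_cst r * x = x * palg_cst r.
Proof. by rewrite palg_cst_mull palg_cst_mulr. Qed.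

Lemma palg_cstM : monoid_morphism palg_cst.
Proof.
by split=> [|r s]; rewrite ?palg_cst_mull /palg_cst ?scale1r ?scalerA.
Qed.

Lemma palg_endomorphism (f : I -> palg) :
    (forall x y, rels x y -> term_val palg_cst f x = term_val palg_cst f y) ->
  exists g : palg -> palg,
    [/\ linear g, monoid_morphism g & forall i, g (pgen rels i) = f i].
Proof.
move=> frels; have [||r x|g [gD gM g1 gC gf]] := palg_lift _ _ _ frels.
- exact: palg_cstB.
- exact: palg_cstM.
- exact: palg_cstC.
exists g; split=> // r x y.
by rewrite gD -[r *: x]palg_cst_mull gM gC palg_cst_mull.
Qed.

(** Anti-endomorphisms are the ring morphisms to the converse ring. *)
Lemma palg_antiendomorphism (f : I -> palg) :
    (forall x y, rels x y -> term_val (A := palg^c) palg_cst f x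
                           = term_val (A := palg^c) palg_cst f y) ->
  exists g : palg -> palg,
    [/\ linear g, g 1 = 1, {morph g : x y / x * y >-> y * x} &
        forall i, g (pgen rels i) = f i].
Proof.
move=> frels; have [||r x|g [gD gM g1 gC gf]] :=
  palg_lift (A := palg^c) _ _ _ frels.
- exact: palg_cstB.
- split=> [|r s]; first exact: (palg_cstM.1).
  by rewrite mulrC; apply: (palg_cstM.2).
- exact: esym (palg_cstC r x).
exists g; split=> // r x y.
rewrite gD -[r *: x]palg_cst_mull gM gC.
by congr (_ + _); apply: palg_cst_mulr.
Qed.

Lemma linear_morphD (f : palg -> palg) : linear f -> {morph f : x y / x + y}.
Proof. by move=> fL x y; rewrite -[x]scale1r fL !scale1r. Qed.

Lemma linear_fixes_cst (f : palg -> palg) :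
  linear f -> f 1 = 1 -> forall r : R, f (r *: (1 : palg)) = r *: (1 : palg).
Proof.
move=> fL f1 r; have fD := linear_morphD fL.
have f0 : f 0 = 0 by apply: (addrI (f 0)); rewrite -fD !addr0.
by rewrite -[r *: _ in LHS]addr0 fL f0 f1 addr0.
Qed.

Lemma palg_morph_ext (f g : palg -> palg) :
    linear f -> monoid_morphism f -> linear g -> monoid_morphism g ->
  (forall i, f (pgen rels i) = g (pgen rels i)) -> f =1 g.
Proof.
move=> fL [f1 fM] gL [g1 gM] fg; elim/palg_gen_ind=> //.
- by move=> r; rewrite !linear_fixes_cst.
- by move=> x y IHx IHy; rewrite !linear_morphD // IHx IHy.
- by move=> x y IHx IHy; rewrite fM gM IHx IHy.
Qed.

Lemma palg_antimorph_ext (f g : palg -> palg) :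
    linear f -> f 1 = 1 -> {morph f : x y / x * y >-> y * x} ->
    linear g -> g 1 = 1 -> {morph g : x y / x * y >-> y * x} ->
  (forall i, f (pgen rels i) = g (pgen rels i)) -> f =1 g.
Proof.
move=> fL f1 fM gL g1 gM fg; elim/palg_gen_ind=> //.
- by move=> r; rewrite !linear_fixes_cst.
- by move=> x y IHx IHy; rewrite !linear_morphD // IHx IHy.
- by move=> x y IHx IHy; rewrite fM gM IHx IHy.
Qed.

Lemma linear_comp (f g : palg -> palg) :
  linear f -> linear g -> linear (f \o g).
Proof. by move=> fL gL r x y /=; rewrite gL fL. Qed.

End PresentedAlgebraMaps.

(** * Alternating products under quadratic relations *)

Section AlternatingProducts.

Fixpoint alt_prod (A : pzRingType) (m : nat) (x y : A) : A :=
  if m is m'.+1 then x * alt_prod m' y x else 1.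

Variable A : pzRingType.
Implicit Types x y : A.

Lemma alt_prodSr m x y :
  alt_prod m.+1 x y = alt_prod m x y * (if odd m then y else x).
Proof.
elim: m x y => [|m IHm] x y; first by rewrite /= mul1r mulr1.
rewrite -[LHS]/(x * alt_prod m.+1 y x) IHm mulrA /=.
by case: (odd m).
Qed.

(** Read backwards, x y x ... with m factors starts with its last factor, which
    is x for m odd and y for m even. *)
Lemma alt_prod_conv m x y :
  alt_prod m (x : A^c) y =
  if odd m then alt_prod m x y else alt_prod m y x.
Proof.
elim: m x y => [//|m IHm] x y; rewrite [LHS]/= IHm !alt_prodSr /=.
by case: (odd m).
Qed.

(** The factor a - x - y turns x Q into - b Q - y x Q, because (a - x) x = - b
    by the quadratic relation; likewise for y. *)
Lemma alt_prod_sub_rec (a b x y : A) k :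
    x * x = a * x + b -> y * y = a * y + b ->
  alt_prod k.+2 x y - alt_prod k.+2 y x =
  (a - x - y) * (alt_prod k.+1 x y - alt_prod k.+1 y x)
  - b * (alt_prod k x y - alt_prod k y x).
Proof.
move=> xx yy; rewrite /=; set p := alt_prod k x y; set q := alt_prod k y x.
have xE : (a - x - y) * (x * q) = - (b * q) - y * (x * q).
  rewrite !mulrBl [x * (x * q)]mulrA xx mulrDl mulrA opprD addrA.
  by rewrite subrr sub0r.
have yE : (a - x - y) * (y * p) = - (b * p) - x * (y * p).
  rewrite addrAC !mulrBl [y * (y * p)]mulrA yy mulrDl mulrA opprD addrA.
  by rewrite subrr sub0r.
rewrite mulrBr xE yE mulrBr opprD !opprK.
rewrite [- _ - _]addrC [_ + x * _]addrC addrACA [- _ + _]addrC.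
by rewrite [- _ + b * p]addrC addrK.
Qed.

Lemma complement_quad (a b z : A) : a * z = z * a ->
  z * z = a * z + b -> (a - z) * (a - z) = a * (a - z) + b.
Proof.
move=> aC zz; rewrite [LHS]mulrBl [z * _]mulrBr zz -aC; congr (_ + _).
by rewrite opprB addrAC subrr add0r.
Qed.

(** The passage from (x, y) to (a - x, a - y) keeps the quadratic relations and
    replaces a - x - y by its opposite, so both sides satisfy the same
    two-step recursion, with the same values for k = 0 and k = 1. *)
Lemma alt_prod_sub (a b x y : A) k :
    (forall z, a * z = z * a) ->
    x * x = a * x + b -> y * y = a * y + b ->
  alt_prod k (a - x) (a - y) - alt_prod k (a - y) (a - x) =
  (-1) ^+ k * (alt_prod k x y - alt_prod k y x).
Proof.
move=> aC xx yy.
have signC n z w : z * ((-1) ^+ n * w) = (-1) ^+ n * (z * w).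
  by rewrite mulrA commr_sign mulrA.
suff [] : alt_prod k (a - x) (a - y) - alt_prod k (a - y) (a - x) =
    (-1) ^+ k * (alt_prod k x y - alt_prod k y x) /\
  alt_prod k.+1 (a - x) (a - y) - alt_prod k.+1 (a - y) (a - x) =
    (-1) ^+ k.+1 * (alt_prod k.+1 x y - alt_prod k.+1 y x) by [].
elim: k => [|k [IHk IHk1]].
  rewrite /= !mulr1 subrr mulr0; split=> //.
  by rewrite expr1 mulN1r [RHS]opprB opprB addrC addrA addrNK.
split=> //.
rewrite !(@alt_prod_sub_rec a b) ?(@complement_quad a b) // IHk IHk1.
have -> : a - (a - x) - (a - y) = - (a - x - y).
  by rewrite subKr !opprB addrCA.
rewrite !signC !exprS !mulN1r opprK [- (a - _ - _) * _]mulNr mulrNN.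
by rewrite -mulrBr.
Qed.

End AlternatingProducts.

(** * Twist, complement and reversal in the Hecke algebra *)

Section HeckeMaps.
Local Open Scope quotient_scope.
Variables (R : comPzRingType) (a b : R) (gT : finGroupType) (S : {set gT}).
Local Notation gen := {s : gT | s \in S}.
Local Notation rels := (hecke_rels a b S).
Local Notation H := (palg rels).
Local Notation pi := (pgen rels).

Lemma term_val_alternating (A : pzRingType) (c : R -> A) (f : gen -> A) m s t :
  c 1 = 1 ->
  term_val c f (@alternating R gT S m (Gen s) (Gen t)) = alt_prod m (f s) (f t).
Proof. by move=> c1; elim: m s t => //= m IHm s t; rewrite IHm. Qed.

Lemma hecke_quad s : pi s * pi s = palg_cst rels a * pi s + palg_cst rels b.
Proof.
rewrite /palg_cst -!palg_piC -!palg_piM -palg_piD.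
exact/palg_eqP/congr_rel/hecke_quadratic.
Qed.

Lemma pi_alternating m s t :
  \pi_H (alternating m (Gen s) (Gen t)) = alt_prod m (pi s) (pi t).
Proof.
elim: m s t => [|m IHm] s t; first by [].
by rewrite palg_piM IHm.
Qed.

Lemma hecke_braid_gen s t : s != t ->
  alt_prod #[val s * val t]%g (pi s) (pi t) =
  alt_prod #[val s * val t]%g (pi t) (pi s).
Proof.
by move=> st; rewrite -!pi_alternating; apply/palg_eqP/congr_rel/hecke_braid.
Qed.

Lemma hecke_rels_val (A : pzRingType) (c : R -> A) (f : gen -> A) : c 1 = 1 ->
    (forall s, f s * f s = c a * f s + c b) ->
    (forall s t, s != t -> alt_prod #[val s * val t]%g (f s) (f t) =
                           alt_prod #[val s * val t]%g (f t) (f s)) ->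
  forall x y, rels x y -> term_val c f x = term_val c f y.
Proof.
move=> c1 quad braid x y [s|s t st]; first exact: quad.
by rewrite !term_val_alternating // braid.
Qed.

(** A bijection of S preserving the Coxeter matrix permutes the relations. *)
Lemma hecke_twist (sigma : gen -> gen) :
    injective sigma ->
    (forall s t, #[val (sigma s) * val (sigma t)]%g = #[val s * val t]%g) ->
  exists f : H -> H,
    [/\ linear f, monoid_morphism f & forall s, f (pi s) = pi (sigma s)].
Proof.
move=> sigma_inj sigma_ord; apply: palg_endomorphism.
apply: hecke_rels_val => [|s|s t st]; first exact: (palg_cstM _).1.
  exact: hecke_quad.
by rewrite -sigma_ord hecke_braid_gen // (inj_eq sigma_inj).
Qed.

Lemma hecke_complement : exists f : H -> H,
  [/\ linear f, monoid_morphism f & forall s, f (pi s) = a *: (1 : H) - pi s].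
Proof.
apply: palg_endomorphism.
have aC z : palg_cst rels a * z = z * palg_cst rels a by apply: palg_cstC.
apply: hecke_rels_val => [|s|s t st]; first exact: (palg_cstM _).1.
  rewrite -/(palg_cst rels a).
  by apply: complement_quad; last exact: hecke_quad.
apply/eqP; rewrite -subr_eq0 (alt_prod_sub _ aC (hecke_quad s) (hecke_quad t)).
by rewrite hecke_braid_gen // subrr mulr0.
Qed.

Lemma hecke_reversal : exists f : H -> H,
  [/\ linear f, f 1 = 1, {morph f : x y / x * y >-> y * x} &
      forall s, f (pi s) = pi s].
Proof.
apply: palg_antiendomorphism.
apply: hecke_rels_val => [|s|s t st]; first exact: (palg_cstM _).1.
  by rewrite [LHS]hecke_quad palg_cstC.
by rewrite !alt_prod_conv hecke_braid_gen.
Qed.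

End HeckeMaps.

(** * The three involutions *)

(** As w0 is its own inverse, s |-> w0 s w0 is a conjugation, hence preserves the
    order of s t. *)
Lemma longest_conj_gen (gT : finGroupType) (S : {set gT})
    (hS : coxeter_system S) (w0 : gT) (hw0 : longest_element hS w0) :
  exists sigma : {s : gT | s \in S} -> {s : gT | s \in S},
    [/\ forall s, val (sigma s) = (w0 * val s * w0)%g, involutive sigma &
        forall s t, #[val (sigma s) * val (sigma t)]%g = #[val s * val t]%g].
Proof.
have [w02 conjS] := longest_element_conj hw0.
pose sigma (s : {s : gT | s \in S}) : {s : gT | s \in S} :=
  exist _ (w0 * val s * w0)%g (conjS _ (valP s)).
exists sigma; split=> // [s|s t].
  by apply: val_inj; rewrite /= !mulgA w02 mul1g -mulgA w02 mulg1.
have w0V : (w0^-1 = w0)%g by apply/eqP; rewrite eq_invg_mul w02.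
by rewrite -[RHS](orderJ _ w0) conjMg !conjgE w0V !mulgA.
Qed.

Theorem lemma4p2 (R : comPzRingType) (a b : R) (gT : finGroupType)
    (S : {set gT}) (hS : coxeter_system S) (w0 : gT)
    (hw0 : longest_element hS w0) :
  let H := hecke_algebra a b S in
  let pi : {s : gT | s \in S} -> H := fun s => hecke_gen a b s in
  exists phi theta chi : H -> H,
    [/\ determined_by (alg_automorphism (hecke_rels a b S))
          (fun f : H -> H => forall s : {s : gT | s \in S},
             exists2 t : {s : gT | s \in S},
               val t = (w0 * val s * w0)%g & f (pi s) = pi t) phi,
        determined_by (alg_automorphism (hecke_rels a b S))
          (fun f : H -> H => forall s, f (pi s) = a *: (1 : H) - pi s) theta &
        determined_by (alg_antiautomorphism (hecke_rels a b S))
          (fun f : H -> H => forall s, f (pi s) = pi s) chi]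
    /\ [/\ phi \o theta =1 theta \o phi,
           phi \o chi =1 chi \o phi &
           theta \o chi =1 chi \o theta]
    /\ [/\ involutive phi, involutive theta & involutive chi].
Proof.
move=> H pi.
have [sigma [sigmaE sigmaK sigma_ord]] := longest_conj_gen hw0.
have [phi [phiL phiM phi_pi]] := hecke_twist a b (inv_inj sigmaK) sigma_ord.
have [theta [thetaL thetaM theta_pi]] := hecke_complement a b S.
have [chi [chiL chi1 chiM chi_pi]] := hecke_reversal a b S.
have [[phi1 phi_mul] [theta1 theta_mul]] := (phiM, thetaM).
have comp_monoid (f g : H -> H) :
    monoid_morphism f -> monoid_morphism g -> monoid_morphism (f \o g).
  by move=> [f1 fM] [g1 gM]; split=> [|x y] /=; rewrite ?g1 ?gM ?f1 ?fM.
have linB (f : H -> H) : linear f -> f 1 = 1 ->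
    forall s, f (a *: (1 : H) - pi s) = a *: (1 : H) - f (pi s).
  move=> fL f1 s; rewrite addrC -scaleN1r fL (linear_fixes_cst fL f1) //.
  by rewrite scaleN1r addrC.
have idM : monoid_morphism (@idfun H) by [].
have idL : linear (@idfun H) by [].
have phiK : involutive phi.
  apply: (palg_morph_ext (linear_comp phiL phiL) (comp_monoid _ _ phiM phiM)
            idL idM) => s.
  by rewrite /= !phi_pi sigmaK.
have thetaK : involutive theta.
  apply: (palg_morph_ext (linear_comp thetaL thetaL)
            (comp_monoid _ _ thetaM thetaM) idL idM) => s.
  by rewrite /= theta_pi linB // theta_pi subKr.
have chiK : involutive chi.
  have chi2M : monoid_morphism (chi \o chi).
    by split=> [|x y] /=; rewrite ?chi1 ?chiM.
  apply: (palg_morph_ext (linear_comp chiL chiL) chi2M idL idM) => s.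
  by rewrite /= !chi_pi.
exists phi, theta, chi; split; last split; last by [].
- split.
  + split=> [|s|g [gL gM _] g_pi]; first by split=> //; apply: inv_bij.
      by exists (sigma s); rewrite ?sigmaE ?phi_pi.
    apply: palg_morph_ext => // s; have [t tE ->] := g_pi s.
    by rewrite phi_pi; congr pi; apply: val_inj; rewrite tE sigmaE.
  + split=> // [|g [gL gM _] g_pi]; first by split=> //; apply: inv_bij.
    by apply: palg_morph_ext => // s; rewrite g_pi theta_pi.
  split=> // [|g [gL g1 gM _] g_pi]; first by split=> //; apply: inv_bij.
  by apply: palg_antimorph_ext => // s; rewrite g_pi chi_pi.
- split.
  + apply: palg_morph_ext; try exact: linear_comp; try exact: comp_monoid.
    by move=> s /=; rewrite theta_pi linB // phi_pi theta_pi.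
  + apply: palg_antimorph_ext; try exact: linear_comp;
      try by [rewrite /= ?phi1 ?chi1 | move=> x y /=; rewrite ?(phi_mul, chiM)].
    by move=> s /=; rewrite phi_pi !chi_pi phi_pi.
  apply: palg_antimorph_ext; try exact: linear_comp;
    try by [rewrite /= ?theta1 ?chi1
           | move=> x y /=; rewrite ?(theta_mul, chiM)].
  by move=> s /=; rewrite theta_pi linB // !chi_pi theta_pi.
Qed.
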